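(* Fix a field $\mathbb{k}$. Let $d>4$ and let $P$ be a $(d-1)$-dimensional (i.e. rank $d$) Buchsbaum (over $\mathbb{k}$) simplicial poset such that, for some integer $k$ with $\frac{d}{2}\le k<d-1$, $\tilde\beta_i(P)=1$ if $i=k$ and $\tilde\beta_i(P)=0$ if $i\ne k$ (for $0\le i\le d-1$), and $h'_j(P)=\binom{d}{j}$ if $j\in\{0,k+1\}$ and $h'_j(P)=0$ otherwise (for $0\le j\le d$). Then $P$ has a $(d-2)$-dimensional face which is contained in at least three $(d-1)$-dimensional faces.
   Context: A simplicial poset is a finite poset with unique minimum $\hat0$ in which every interval $[\hat0,\tau]$ is a Boolean lattice; an element of rank $i$ (rank of $[\hat0,\tau]$) is an $(i-1)$-dimensional face, and $f_{i-1}(P)$ counts them. $|P|$ is the regular CW complex with simplicial cells whose face poset is $P$; $\tilde\beta_i(P)=\dim_{\mathbb{k}}\tilde H_i(|P|;\mathbb{k})$. For rank $d$, $h_j(P)=\sum_{i=0}^j(-1)^{j-i}\binom{d-i}{d-j}f_{i-1}(P)$ and $h'_j(P)=h_j(P)+\binom{d}{j}\sum_{i=0}^{j-1}(-1)^{j-i-1}\tilde\beta_{i-1}(P)$. $P$ is Buchsbaum over $\mathbb{k}$ if its order complex $\Delta(P)$ (chains in $P\setminus\{\hat0\}$) is Buchsbaum: pure, and the link of each vertex $L$ is Cohen–Macaulay, meaning $\tilde H_i(\mathrm{lk}_L(\tau);\mathbb{k})=0$ for all faces $\tau$ of $L$ (including $\emptyset$) and all $i<\dim\mathrm{lk}_L(\tau)$.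 *)

(* Defs.v *)
From HB Require Import structures.
From mathcomp Require Import all_boot all_order all_algebra.

Set Implicit Arguments.
Unset Strict Implicit.
Unset Printing Implicit Defensive.

Import Order.TTheory GRing.Theory Num.Theory.
Local Open Scope ring_scope.

(* Oriented chain complex of a regular cell complex with simplicial cells.
   [cells i] is the set of i-dimensional cells (with the empty cell in degree
   -1, so that the homology is reduced), [vs s] is the vertex set of the cell
   s, and [le t s] says that t is a face of s.  Every cell is oriented by the
   enumeration order of the vertex type V, so the facet of s that misses the
   vertex v has incidence (-1) ^ (position of v in vs s). *)
Section CellularHomology.

Variables (F : fieldType) (V T : finType).
Variables (cells : int -> {set T}) (vs : T -> {set V}) (le : rel T).

Definition vertex_pos (s : {set V}) (v : V) : nat :=
  #|[set u in s | (enum_rank u < enum_rank v)%N]|.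

(* When t is a facet of s, vs s :\: vs t has exactly one element. *)
Definition incidence (s t : T) : F :=
  if le t s then \sum_(v in vs s :\: vs t) (-1) ^+ vertex_pos (vs s) v else 0.

(* Row s is the boundary of s.  This is the boundary map when j = i - 1; i and
   j are independent to avoid casts between cells (i + 1 - 1) and cells i. *)
Definition boundary_mx (i j : int) : 'M[F]_(#|cells i|, #|cells j|) :=
  \matrix_(a, b) incidence (enum_val a) (enum_val b).

(* The dimension of a complement of the boundaries in the cycles. *)
Definition cell_betti (i : int) : nat :=
  \rank (kermx (boundary_mx i (i - 1)) :\: boundary_mx (i + 1) i)%MS.

End CellularHomology.

Section SimplicialComplex.

Variables (F : fieldType) (V : finType).
Implicit Types (K : {set {set V}}) (s t : {set V}).

Definition cdim K : int := (\max_(s in K) #|s|)%:Z - 1.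

Definition simplices K (i : int) : {set {set V}} :=
  [set s in K | #|s|%:Z == i + 1].

Definition complex_betti K (i : int) : nat :=
  cell_betti F (simplices K) id (fun t s => t \subset s) i.

Definition link K t : {set {set V}} :=
  [set s in K | [disjoint s & t] && (s :|: t \in K)].

Definition pure K : Prop :=
  forall s, maxset (fun t => t \in K) s -> #|s|%:Z - 1 = cdim K.

Definition cohen_macaulay K : Prop :=
  forall t, t \in K ->
  forall i : int, i < cdim (link K t) -> complex_betti (link K t) i = 0%N.

Definition buchsbaum_complex K : Prop :=
  pure K /\ forall v, [set v] \in K -> cohen_macaulay (link K [set v]).

End SimplicialComplex.

Section SimplicialPoset.

Variables (F : fieldType) (disp : Order.disp_t) (P : finBPOrderType disp).
Implicit Types (x y t : P) (c : {set P}).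

Definition simplicial_poset : Prop :=
  forall t, exists n (f : {x : P | (x <= t)%O} -> {set 'I_n}),
    bijective f /\
    forall x y : {x : P | (x <= t)%O}, (f x \subset f y) = (val x <= val y)%O.

Definition chain c : bool := [forall x in c, forall y in c, (x >=< y)%O].

(* The rank of an interval is the length of its longest chains. *)
Definition prank x : nat :=
  (\max_(c | chain c && (c \subset [set y | (y <= x)%O])) #|c|).-1.

Definition poset_rank : nat := \max_x prank x.

Definition faces (i : int) : {set P} := [set x | (prank x)%:Z == i + 1].

Definition vertices x : {set P} := [set v in faces 0 | (v <= x)%O].

(* Reduced cellular homology of the regular CW complex |P|. *)
Definition poset_betti (i : int) : nat :=
  cell_betti F faces vertices (fun x y => (x <= y)%O) i.

Definition order_complex : {set {set P}} :=
  [set c | chain c && (\bot%O \notin c)].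

Definition buchsbaum_poset : Prop := buchsbaum_complex F order_complex.

Definition fnum (i : int) : nat := #|faces i|.

Definition hnum (j : nat) : int :=
  let d := poset_rank in
  \sum_(i < j.+1)
    (-1) ^+ (j - i) * ('C(d - i, d - j))%:Z * (fnum (i%:Z - 1))%:Z.

Definition hnum' (j : nat) : int :=
  let d := poset_rank in
  hnum j + ('C(d, j))%:Z *
    \sum_(i < j) (-1) ^+ (j - i - 1) * (poset_betti (i%:Z - 1))%:Z.

End SimplicialPoset.

(* Main.v *)
Require Import Defs.
From HB Require Import structures.
From mathcomp Require Import all_boot all_order all_algebra.
From mathcomp Require Import zify ring.

Set Implicit Arguments.
Unset Strict Implicit.
Unset Printing Implicit Defensive.

Import Order.TTheory GRing.Theory Num.Theory.
Local Open Scope ring_scope.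

(* Since all Betti numbers are known, h' determines h, and inverting the
   h-transform gives [f_(d-1) = 1 + 'C(d-1, k)] facets and
   [f_(d-2) = d (1 + 'C(d-2, k))] ridges.  Every facet lies above exactly d
   ridges, so if every ridge were in at most two facets then
   [1 + 'C(d-1, k) <= 2 (1 + 'C(d-2, k))], that is
   ['C(d-2, k-1) <= 'C(d-2, k) + 1].  This fails for [d/2 <= k < d-1] because
   the binomial coefficients decrease by at least 2 there. *)

(** * Ranks and face counts in Boolean intervals *)

Section BooleanIntervals.

Variables (disp : Order.disp_t) (P : finBPOrderType disp).

Section Interval.

Variables (t : P) (n : nat) (f : {x : P | (x <= t)%O} -> {set 'I_n}).
Hypothesis f_bij : bijective f.
Hypothesis f_mono : forall x y : {x : P | (x <= t)%O},
  (f x \subset f y) = (val x <= val y)%O.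

(** Cardinality of the image under [f] is injective on a chain, since nested sets of equal size
    coincide, and it takes values in 0, ..., [#|f x|]. *)
Lemma chain_card_le (x : {x : P | (x <= t)%O}) (c : {set P}) :
  chain c -> c \subset [set y | (y <= val x)%O] -> (#|c| <= #|f x|.+1)%N.
Proof.
move=> /forall_inP c_chain /subsetP c_le.
(* The default [x] of [insubd] is never reached on [c], whose elements all lie below [t]. *)
have valF y : y \in c -> val (insubd x y) = y.
  move=> yc; rewrite val_insubd; move: (c_le _ yc); rewrite inE => yx.
  by rewrite (le_trans yx (valP x)).
pose h y : 'I_(#|f x|.+1) := inord #|f (insubd x y)|.
have hE y : y \in c -> h y = #|f (insubd x y)| :> nat.
  move=> yc; rewrite inordK // ltnS subset_leq_card // f_mono valF //.
  by have := c_le _ yc; rewrite inE.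
suff h_inj : {in c &, injective h}.
  by rewrite -(card_in_imset h_inj) -[leqRHS]card_ord max_card.
have wlog_le y z : y \in c -> z \in c -> h y = h z -> (y <= z)%O -> y = z.
  move=> yc zc hyz yz; rewrite -(valF y) // -(valF z) //; congr val.
  apply: (bij_inj f_bij); apply/eqP; rewrite eqEcard f_mono !valF // yz /=.
  by rewrite -hE // -hE // hyz.
move=> y z yc zc hyz; have /forall_inP/(_ z zc)/orP[yz|zy] := c_chain y yc.
  exact: wlog_le.
by apply/esym/wlog_le.
Qed.

(** Deleting the elements of [f x] one at a time gives a chain from [x] down to the element with
    empty image. *)
Lemma chain_card_attained (x : {x : P | (x <= t)%O}) :
  exists2 c : {set P}, chain c && (c \subset [set y | (y <= val x)%O])
    & #|c| = #|f x|.+1.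
Proof.
have [g fK gK] := f_bij.
have [m] := ubnP #|f x|; elim: m => // m IHm in x * => fx_lt.
have [fx0|[a a_fx]] := set_0Vmem (f x).
  exists [set val x]; last by rewrite cards1 fx0 cards0.
  apply/andP; split; last by rewrite sub1set inE.
  apply/forall_inP=> y /set1P->; apply/forall_inP=> z /set1P->.
  exact: comparablexx.
have := cardsD1 a (f x); rewrite a_fx add1n => card_fx.
pose y := g (f x :\ a).
have yx : (val y < val x)%O.
  by rewrite lt_leAnge -!f_mono gK subD1set subsetD1 a_fx andbF.
have [|c /andP[/forall_inP c_chain /subsetP c_le] c_card] := IHm y.
  by rewrite gK -ltnS -card_fx.
have c_lt z : z \in c -> (z < val x)%O.
  by move=> /c_le; rewrite inE => /le_lt_trans; apply.
exists (val x |: c).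
  apply/andP; split.
    apply/forall_inP=> u /setU1P[->|uc]; apply/forall_inP=> v /setU1P[->|vc].
    - exact: comparablexx.
    - exact/ge_comparable/ltW/c_lt.
    - exact/le_comparable/ltW/c_lt.
    - exact: (forall_inP (c_chain u uc)).
  by apply/subsetP=> u /setU1P[->|/c_lt/ltW]; rewrite inE.
rewrite cardsU1 c_card gK card_fx (_ : _ \notin _) //.
by apply/negP=> /c_lt; rewrite ltxx.
Qed.

Lemma prank_card (x : {x : P | (x <= t)%O}) : prank (val x) = #|f x|.
Proof.
rewrite /prank -[RHS]/(#|f x|.+1.-1); congr _.-1; apply/eqP.
rewrite eqn_leq; apply/andP; split.
  by apply/bigmax_leqP=> c /andP[]; apply: chain_card_le.
by have [c c_ok <-] := chain_card_attained x; apply: leq_bigmax_cond.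
Qed.

End Interval.

Hypothesis P_simplicial : simplicial_poset P.

(** The Boolean isomorphism sends [t] to the full set and rank to cardinality, so the elements
    counted here correspond to the [r]-subsets of a set of size [prank t]. *)
Lemma card_faces_below (t : P) (r : nat) :
  #|[set s | (s <= t)%O & prank s == r]| = 'C(prank t, r).
Proof.
have [n [f [f_bij f_mono]]] := P_simplicial t.
pose t' : {x : P | (x <= t)%O} := exist _ t (lexx t).
have rank_f := prank_card f_bij f_mono.
have [g fK gK] := f_bij.
have ft : f t' = setT.
  by apply/eqP; rewrite -subTset -(gK setT) f_mono (valP (g setT)).
have -> : prank t = n by rewrite -[t]/(val t') rank_f ft cardsT card_ord.
rewrite -[n in RHS]card_ord -card_draws.
have g_inj : injective (fun A => val (g A)).
  by move=> A B /val_inj/(can_inj gK).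
rewrite -(card_imset _ g_inj); apply: eq_card => s; rewrite inE.
apply/andP/imsetP => [[st s_rank]|[A]].
  exists (f (exist _ s st)); last by rewrite fK.
  by rewrite inE -rank_f.
by rewrite inE => A_card ->; rewrite (valP (g A)) rank_f gK.
Qed.

Lemma double_count_incidences (r : nat) :
  (\sum_(s in faces P (r%:Z - 1))
     #|[set t in faces P r%:Z | (s <= t)%O]| = r.+1 * fnum P r)%N.
Proof.
(* Summed over the larger faces instead, each term is ['C(r.+1, r)], because an [r]-dimensional face
   has rank [r.+1]. *)
transitivity (\sum_(t in faces P r%:Z)
                #|[set s in faces P (r%:Z - 1) | (s <= t)%O]|)%N.
  under eq_bigr do rewrite -sum1dep_card big_mkcondr.
  rewrite exchange_big; apply: eq_bigr => t _.
  by rewrite -big_mkcondr sum1dep_card.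
rewrite mulnC -sum_nat_const; apply: eq_bigr => t; rewrite inE => /eqP t_rank.
have {}t_rank : prank t = r.+1 by lia.
rewrite -(binSn r) -t_rank -card_faces_below; apply: eq_card => s.
by rewrite !inE subrK andbC.
Qed.

Lemma fnum0_gt0 : (0 < poset_rank P)%N -> (0 < fnum P 0)%N.
Proof.
case: (bigop.eq_bigmax (@prank _ P)); first by apply/card_gt0P; exists \bot%O.
move=> t rank_t; rewrite /poset_rank rank_t => t_gt0.
have : (0 < 'C(prank t, 1))%N by rewrite bin1.
rewrite -card_faces_below => /card_gt0P[v]; rewrite inE => /andP[_ v_rank].
by apply/card_gt0P; exists v; rewrite inE (eqP v_rank).
Qed.

End BooleanIntervals.

(** * Binomial identities and an inequality *)

Lemma mul_bin_bin (n i j : nat) :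
  ('C(n - j, i) * 'C(n, j) = 'C(n, i) * 'C(n - i, j))%N.
Proof.
(* Both sides vanish when [i + j > n]; otherwise both are the multinomial coefficient n! / (i! j!
   (n-i-j)!). *)
have [ijn|ijn] := leqP (i + j) n; last first.
  rewrite mulnC; have [jn|jn] := leqP j n; last first.
    by rewrite (bin_small jn) [X in _ = (_ * X)%N]bin_small ?muln0 //; lia.
  rewrite ['C(n - j, i)]bin_small; last by lia.
  have [i_n|i_n] := leqP i n; last by rewrite ['C(n, i)]bin_small ?muln0.
  by rewrite ['C(n - i, j)]bin_small ?muln0 //; lia.
apply/eqP; rewrite -(eqn_pmul2r (fact_gt0 i)) -(eqn_pmul2r (fact_gt0 j)).
rewrite -(eqn_pmul2r (fact_gt0 (n - i - j))); apply/eqP.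
have e1 := @bin_fact n j ltac:(lia); have e2 := @bin_fact n i ltac:(lia).
have e3 := @bin_fact (n - j) i ltac:(lia).
have e4 := @bin_fact (n - i) j ltac:(lia).
rewrite (_ : n - j - i = n - i - j)%N in e3; last by lia.
transitivity (n`!); first by rewrite -e1 -e3; ring.
by rewrite -e2 -e4; ring.
Qed.

(** Pascal's rule makes the sum telescope. *)
Lemma alternating_bin_sum (n k m : nat) : (k <= m)%N ->
  \sum_(j < m.+1 | (k < j)%N) (-1) ^+ (j - k.+1) * ('C(n.+1, j))%:Z
    = ('C(n, k))%:Z - (-1) ^+ (m - k) * ('C(n, m))%:Z :> int.
Proof.
elim: m => [|m IHm] km.
  have -> : k = 0%N by lia.
  by rewrite big_mkcond big_ord1 /= bin0 mul1r subrr.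
rewrite big_mkcond big_ord_recr -big_mkcond /=.
have [{}km|mk] := ltnP k m.+1; last first.
  have -> : k = m.+1 by lia.
  rewrite subnn expr0 mul1r subrr addr0 big_pred0 // => j.
  by apply/negbTE; rewrite -leqNgt ltnW.
rewrite IHm // binS PoszD subSS subSn // exprS; ring.
Qed.

(** Both sides are the coefficient of X^r in X^n = (-1 + (1 + X))^n. *)
Lemma bin_inversion (n r : nat) :
  \sum_(m < n.+1) (-1) ^+ (n - m) * ('C(n, m))%:Z * ('C(m, r))%:Z
    = (n == r)%:Z :> int.
Proof.
have binE m : ((1 + 'X : {poly int}) ^+ m)`_r = ('C(m, r))%:Z.
  rewrite (_ : _ ^+ m = \poly_(i < m.+1) ('C(m, i))%:Z).
    by rewrite coef_poly ltnS; case: leqP => // mr; rewrite bin_small.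
  rewrite exprDn poly_def; apply: eq_bigr => i _.
  by rewrite expr1n mul1r -scaler_nat natz.
have := congr1 (fun p : {poly int} => p`_r) (exprDn (-1) (1 + 'X) n).
rewrite addKr coefXn eq_sym natz => ->; rewrite coef_sum.
apply: eq_bigr => m _; rewrite coefMn -polyC1 -polyCN -polyC_exp coefCM polyC1.
by rewrite binE -mulr_natr natz mulrAC.
Qed.

(** Since (j+1) C(n,j+1) = (n-j) C(n,j), the difference of the two binomials times j+1 is (2j+1-n)
    C(n,j) >= C(n,j). When j+2 <= n this exceeds j+1, so the difference is at least 2; the case n =
    j+1 is direct. *)
Lemma bin_diff_ge2 (n j : nat) :
  (2 < n)%N -> (n <= 2 * j)%N -> (j < n)%N -> ('C(n, j.+1) + 2 <= 'C(n, j))%N.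
Proof.
move=> n_gt2 nj j_lt; have [->|jn] := eqVneq n j.+1.
  by rewrite binn binSn; lia.
have bin_gt : (j.+1 < 'C(n, j))%N.
  apply: leq_trans (leq_bin2l j (_ : j.+2 <= n)%N); last by lia.
  case: j nj {j_lt jn} => [|j] nj; first by lia.
  rewrite binS binSn;
  have : (0 < 'C(j.+2, j))%N by rewrite bin_gt0; lia.
  lia.
have := mul_bin_left n j; nia.
Qed.

(** * From h' to h to face numbers *)

Section HNumbers.

Variables (disp : Order.disp_t) (P : finBPOrderType disp).

(** Inversion of the h-transform: after exchanging the sums, [bin_inversion] keeps only the term i =
    d - r. *)
Lemma fnum_of_hnum (d r : nat) : poset_rank P = d -> (r <= d)%N ->
  \sum_(j < d.+1) ('C(d - j, r))%:Z * hnum P j = (fnum P ((d - r)%:Z - 1))%:Z.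
Proof.
move=> P_rank r_le.
pose f i := (fnum P (i%:Z - 1))%:Z.
have hE (j : 'I_d.+1) : hnum P j =
    \sum_(i < d.+1) (-1) ^+ (j - i) * ('C(d - i, d - j))%:Z * f i.
  rewrite /hnum P_rank.
  rewrite (big_ord_widen d.+1
    (fun i => (-1) ^+ (j - i) * ('C(d - i, d - j))%:Z * f i)) //.
  rewrite big_mkcond; apply: eq_bigr => i _; case: ltnP => // ji.
  by rewrite bin_small ?mulr0 ?mul0r //; have := ltn_ord i; lia.
under eq_bigr do rewrite hE mulr_sumr.
rewrite exchange_big /=.
have inner (i : 'I_d.+1) :
    \sum_(j < d.+1) ('C(d - j, r))%:Z *
      ((-1) ^+ (j - i) * ('C(d - i, d - j))%:Z * f i) =
    ((d - i)%N == r)%:Z * f i.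
  (* The two sums match under m = d - j; the terms with m > d - i are zero. *)
  rewrite -bin_inversion mulr_suml.
  rewrite (big_ord_widen d.+1 (fun m =>
    (-1) ^+ (d - i - m) * ('C(d - i, m))%:Z * ('C(m, r))%:Z * f i)); last by lia.
  rewrite [RHS]big_mkcond [LHS](reindex_inj rev_ord_inj); apply: eq_bigr => m _ /=.
  have m_lt := ltn_ord m.
  rewrite subSS (_ : d - (d - m) = m)%N; last by lia.
  case: ltnP => im; last by rewrite (bin_small im) !(mulr0, mul0r).
  rewrite (_ : d - m - i = d - i - m)%N; [ring|lia].
under eq_bigr do rewrite inner.
have dr_lt : (d - r < d.+1)%N by lia.
rewrite (bigD1 (Ordinal dr_lt)) //= big1 ?addr0.
  by rewrite (_ : (_ == r) = true) ?mul1r //; lia.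
move=> i /eqP/val_eqP /= ir; rewrite (_ : (_ == r) = false) ?mul0r //.
by apply/negbTE; have := ltn_ord i; lia.
Qed.

Variables (F : fieldType) (d k : nat).
Hypotheses (P_rank : poset_rank P = d) (k_gt0 : (0 < k)%N).
Hypothesis betti_P : forall i : nat, (i <= d - 1)%N ->
  poset_betti F P i%:Z = if i == k then 1%N else 0%N.
Hypothesis h'_P : forall j : nat, (j <= d)%N ->
  hnum' F P j = if (j == 0%N) || (j == k.+1) then ('C(d, j))%:Z else 0.

Lemma betti_sum (j : nat) : (j <= d)%N ->
  \sum_(i < j) (-1) ^+ (j - i - 1) * (poset_betti F P (i%:Z - 1))%:Z =
  (if (0 < j)%N then (-1) ^+ (j - 1) * (poset_betti F P (- 1))%:Z else 0) +
  (if (k.+1 < j)%N then (-1) ^+ (j - k.+2) else 0) :> int.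
Proof.
case: j => [|j] j_le; first by rewrite big_ord0.
rewrite big_ord_recl /= sub0r subn0; congr (_ + _).
rewrite ltnS.
(* With the degree -1 term split off, the shifted index [i] is the homological degree, and only
   degree [k] contributes. *)
transitivity (\sum_(i < j | i == k :> nat) (-1) ^+ (j.+1 - k.+2) : int).
  rewrite [RHS]big_mkcond; apply: eq_bigr => i _.
  rewrite /bump add1n (_ : i.+1%:Z - 1 = i%:Z); last by lia.
  rewrite betti_P; last by have := ltn_ord i; lia.
  case: eqP => [->|_]; last by rewrite mulr0.
  by rewrite mulr1 (_ : j.+1 - k.+1 - 1 = j.+1 - k.+2)%N //; lia.
case: ltnP => [kj|jk]; last first.
  by rewrite big_pred0 // => i; apply/eqP; have := ltn_ord i; lia.
by rewrite (big_pred1 (Ordinal kj)).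
Qed.

(* From [h'_1 = 0] and [h'_0 = 1], with b the Betti number in degree -1, one
   gets [f_0 + d b = d], so that b < 1 without computing any homology. *)
Lemma betti_N1 : (0 < d)%N -> (0 < fnum P 0)%N -> poset_betti F P (- 1) = 0%N.
Proof.
move=> d_gt0 f0_gt0.
have := h'_P (leq0n d); have := h'_P d_gt0.
rewrite /hnum' !betti_sum // /hnum P_rank big_ord1 !big_ord_recl big_ord0 /=.
rewrite !subn0 /bump /= addn0 !subnn binn bin0 bin1 !expr0 ?expr1 subrr sub0r.
rewrite (_ : (1 == k.+1)%N = false); last by lia.
rewrite (_ : 'C(d, d - 1) = d); last by rewrite bin_sub ?bin1.
set b := poset_betti _ _ _; set f0 := fnum P 0.
rewrite binn !(mul1r, mulr1, mulr0, addr0, add0r) mulN1r mulNr => h1_eq f_N1.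
rewrite f_N1 mulr1 in h1_eq; case: b h1_eq => // b h1_eq.
have : (0 <= d * b)%N by []; nia.
Qed.

(** The exceptional value of h' at j = k+1, where the Betti correction is still zero, is exactly the
    first term of the alternating pattern that the correction produces for j > k+1. *)
Lemma hnumE (j : nat) : (j <= d)%N -> poset_betti F P (- 1) = 0%N ->
  hnum P j = (j == 0%N)%:Z +
    (if (k < j)%N then (-1) ^+ (j - k.+1) * ('C(d, j))%:Z else 0).
Proof.
move=> j_le b0; have := h'_P j_le.
rewrite /hnum' betti_sum // P_rank b0 mulr0 if_same add0r => /(canRL (addrK _)) ->.
case: (ltngtP k.+1 j) => [kj|jk|<-]; last 1 first.
- by rewrite orbT subnn mulr0 subr0 mul1r add0r.
- rewrite (_ : (j == 0%N) = false) /=; last by lia.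
  rewrite (_ : (j - k.+1 = (j - k.+2).+1)%N) ?exprS; [ring|lia].
rewrite mulr0 subr0 orbF addr0.
by case: eqP => [->|]; rewrite ?bin0.
Qed.

Lemma fnumE (r : nat) : (r < d)%N -> (k < d)%N -> poset_betti F P (- 1) = 0%N ->
  fnum P ((d - r)%:Z - 1) = ('C(d, r) * (1 + 'C(d - r - 1, k)))%N.
Proof.
move=> r_lt k_lt b0; apply/eqP; rewrite -eqz_nat -fnum_of_hnum // 1?ltnW //.
have -> : \sum_(j < d.+1) ('C(d - j, r))%:Z * hnum P j =
    ('C(d, r))%:Z * (1 + \sum_(j < d.+1 | (k < j)%N)
       (-1) ^+ (j - k.+1) * ('C((d - r - 1).+1, j))%:Z).
  rewrite mulrDr mulr1 mulr_sumr [in RHS]big_mkcond /=.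
  rewrite big_ord_recl [X in _ = _ + X]big_ord_recl /= add0r subn0.
  rewrite hnumE //= addr0 mulr1; congr (_ + _); apply: eq_bigr => j _.
  rewrite hnumE //= add0r; case: ifP => _; last by rewrite mulr0.
  rewrite (_ : (d - r - 1).+1 = d - r)%N; last by lia.
  (* [mul_bin_bin] trades C(d-j,r) C(d,j) for C(d,r) C(d-r,j), which frees the factor C(d,r) from
     the sum. *)
  rewrite mulrCA [in RHS]mulrCA -!PoszM; congr (_ * _).
  by rewrite mul_bin_bin.
rewrite alternating_bin_sum; last by lia.
(* The upper end of the telescoping sum is C(d-r-1, d) = 0. *)
by rewrite (@bin_small _ d); last lia; rewrite mulr0 subr0; lia.
Qed.

End HNumbers.

Theorem theorem5p2 (F : fieldType) (disp : Order.disp_t)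
    (P : finBPOrderType disp) (d k : nat)
    (d_gt4 : (4 < d)%N)
    (P_simplicial : simplicial_poset P)
    (P_rank : poset_rank P = d)
    (P_buchsbaum : buchsbaum_poset F P)
    (k_ge : (d <= 2 * k)%N) (k_lt : (k < d - 1)%N)
    (betti_P : forall i : nat, (i <= d - 1)%N ->
       poset_betti F P i%:Z = if i == k then 1%N else 0%N)
    (h'_P : forall j : nat, (j <= d)%N ->
       hnum' F P j =
         if (j == 0%N) || (j == k.+1) then ('C(d, j))%:Z else 0) :
  exists2 s : P, s \in faces P (d%:Z - 2) &
    (3 <= #|[set t in faces P (d%:Z - 1) | (s <= t)%O]|)%N.
Proof.
have [k_gt0 k_ltd d_gt0 d_gt1] : [/\ 0 < k, k < d, 0 < d & 1 < d]%N.
  by split; lia.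
have f0_gt0 : (0 < fnum P 0)%N by apply: fnum0_gt0; rewrite ?P_rank.
have b0 := betti_N1 P_rank k_gt0 betti_P h'_P d_gt0 f0_gt0.
(* Facets are the case r = 0 and ridges the case r = 1. *)
have f_facets := fnumE P_rank k_gt0 betti_P h'_P d_gt0 k_ltd b0.
have f_ridges := fnumE P_rank k_gt0 betti_P h'_P d_gt1 k_ltd b0.
apply/exists_inP; apply/contraT; rewrite negb_exists_in => /forall_inP few.
have := double_count_incidences P_simplicial (d - 1)%N.
rewrite (_ : (d - 1)%:Z - 1 = d%:Z - 2); last by lia.
rewrite (_ : (d - 1)%:Z = d%:Z - 1); last by lia.
rewrite (_ : (d - 1).+1 = d); last by lia.
move=> double_count; have : (d * fnum P (d%:Z - 1) <= fnum P (d%:Z - 2) * 2)%N.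
  rewrite -double_count -sum_nat_const.
  by apply: leq_sum => s s_ridge; rewrite -ltnS ltnNge few.
move: f_facets f_ridges; rewrite !subn0 bin0 bin1 mul1n => ->.
rewrite (_ : (d - 1)%:Z - 1 = d%:Z - 2); last by lia.
move=> ->; rewrite -mulnA leq_pmul2l; last by lia.
(* With n = d-2 and j = k-1, the conditions 2 < n, n <= 2j and j < n are d > 4, d <= 2k and k < d-1.
   Pascal's rule for C(d-1,k) then contradicts the double count. *)
have := @bin_diff_ge2 (d - 2) (k - 1) ltac:(lia) ltac:(lia) ltac:(lia).
have := binS (d - 2) (k - 1).
have -> : (d - 2).+1 = (d - 1)%N by lia.
have -> : (k - 1).+1 = k by lia.
have -> : (d - 1 - 1 = d - 2)%N by lia.
by move=> ->; clear; lia.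
Qed.
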